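(* Let $\gamma\in\mathrm{Isom}(\mathbb{E})$ be a hyperbolic isometry of three-dimensional Minkowski space without fixed points, with linear part $g$. Choose the origin on the $\gamma$-invariant line $C_\gamma$ and set $$\mathcal{B}_\gamma=\{p_-\mathsf{x}^-(g)+p_+\mathsf{x}^+(g)+p_o\mathsf{x}^o(g) : p_-p_+<0\},$$ $$\mathcal{G}^+_\gamma=\{p_-\mathsf{x}^-(g)+p_+\mathsf{x}^+(g)+p_o\mathsf{x}^o(g) : p_-,p_+\ge 0\},\qquad \mathcal{G}^-_\gamma=\{p_-\mathsf{x}^-(g)+p_+\mathsf{x}^+(g)+p_o\mathsf{x}^o(g) : p_-,p_+\le 0\}.$$ Then: (1) $\mathcal{T}(\langle\gamma\rangle)=\mathcal{B}_\gamma$, and the CTC region of $\mathbb{E}/\langle\gamma\rangle$ is $\mathcal{B}_\gamma/\langle\gamma\rangle$; (2) $\mathcal{F}(\langle\gamma\rangle)=\mathcal{G}^+_\gamma\cup\mathcal{G}^-_\gamma$; (3) $\mathcal{G}^+_\gamma$ is future complete and $\mathcal{G}^-_\gamma$ is past complete; (4) all closed curves in $\mathcal{G}^+_\gamma/\langle\gamma\rangle$ and $\mathcal{G}^-_\gamma/\langle\gamma\rangle$ are spacelike.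
   Context: $\mathbb{E}$ is the affine space modeled on $\mathbb{R}^{2,1}=\mathbb{R}^3$ with the form $\mathbb{B}((x,y,z),(u,v,w))=xu+yv-zw$; once an origin is chosen, points are identified with vectors. A vector $v$ is timelike if $\mathbb{B}(v,v)<0$, lightlike (null) if $\mathbb{B}(v,v)=0$, spacelike if $\mathbb{B}(v,v)>0$. A timelike or nonzero lightlike vector is future (resp. past) directed if its third coordinate is positive (resp. negative). A set $Y\subset\mathbb{E}$ is future (resp. past) complete if for every $p\in Y$ every future (resp. past) directed ray starting at $p$ (i.e. $\{p+tv:t\ge0\}$ with $v$ future, resp. past, directed) remains in $Y$. $\mathrm{Isom}(\mathbb{E})$ is the group of affine isometries $\gamma(p)=g(p)+v$, with linear part $g\in \mathrm{O}(2,1)$ and translational part $v\in\mathbb{R}^{2,1}$; only isometries preserving orientation and time-orientation (linear part in the identity component of $\mathrm{SO}(2,1)$) are considered. Such an isometry is hyperbolic if $\mathrm{tr}(g)>3$. For hyperbolic $\gamma$ with linear part $g$: $g$ has eigenvalues $\lambda<1<\lambda^{-1}$ with null future-directed eigenvectors $\mathsf{x}^-(g)$ (eigenvalue $\lambda$) and $\mathsf{x}^+(g)$ (eigenvalue $\lambda^{-1}$), normalized so that $\mathbb{B}(\mathsf{x}^-(g),\mathsf{x}^+(g))=-1$; $\mathsf{x}^o(g)$ is the $1$-eigenvector with $\mathbb{B}(\mathsf{x}^o(g),\mathsf{x}^o(g))=1$ such that $(\mathsf{x}^-(g),\mathsf{x}^+(g),\mathsf{x}^o(g))$ is a right-handed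 basis. $C_\gamma$ is the unique $\gamma$-invariant line; it is parallel to $\mathsf{x}^o(g)$. Since $\gamma$ has no fixed points, $\Gamma=\langle\gamma\rangle$ acts freely and properly discontinuously on $\mathbb{E}$, and $\mathbb{E}/\Gamma$ is a flat Lorentz manifold, inheriting its local causal structure from $\mathbb{E}$. A timelike curve in $\mathbb{E}/\Gamma$ is a $C^1$ path $c:[0,1]\to \mathbb{E}/\Gamma$ all of whose tangent vectors are timelike; likewise a curve is spacelike if all its tangent vectors are spacelike. A curve $c$ is closed if $c(0)=c(1)$. The CTC region of $\mathbb{E}/\Gamma$ is the set of points lying on some closed timelike curve. $\mathcal{T}(\Gamma)$ is the set of $p\in\mathbb{E}$ whose image $[p]$ lies in the CTC region of $\mathbb{E}/\Gamma$, and $\mathcal{F}(\Gamma)=\mathbb{E}\setminus\mathcal{T}(\Gamma)$ is the region whose quotient is free of closed timelike curves.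
   Formalization: Item (4) is proved for closed C^1 curves of definite causal type (all tangents spacelike, or all tangents timelike or nonzero lightlike); for arbitrary closed curves it is false, since constant paths and small loops with tangents of mixed type lie in these regions. *)

(* Defs.v *)
From HB Require Import structures.
From mathcomp Require Import all_boot all_order all_algebra.
From mathcomp Require Import all_classical all_reals all_analysis.
Set Implicit Arguments.
Unset Strict Implicit.
Unset Printing Implicit Defensive.
Import Order.TTheory GRing.Theory Num.Theory.
Import numFieldNormedType.Exports.
Local Open Scope classical_set_scope.
Local Open Scope ring_scope.

(* Points of the affine space E and vectors of R^{2,1} are both given by their
   coordinate columns in R^3; no relation between the zero column and the
   isometry under study is assumed. *)

Section MinkowskiSpace.
Variable R : realType.
Implicit Types (u v p : 'cV[R]_3) (Y : set 'cV[R]_3).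

Definition mink u v : R := u 0 0 * v 0 0 + u 1 0 * v 1 0 - u 2%:R 0 * v 2%:R 0.

Definition timelike v : Prop := mink v v < 0.
Definition lightlike v : Prop := mink v v = 0.
Definition spacelike v : Prop := 0 < mink v v.
Definition causal v : Prop := timelike v \/ (lightlike v /\ v <> 0).

Definition future_directed v : Prop := causal v /\ 0 < v 2%:R 0.
Definition past_directed v : Prop := causal v /\ v 2%:R 0 < 0.

Definition future_complete Y : Prop :=
  forall p v (t : R), Y p -> future_directed v -> 0 <= t -> Y (p + t *: v).
Definition past_complete Y : Prop :=
  forall p v (t : R), Y p -> past_directed v -> 0 <= t -> Y (p + t *: v).

End MinkowskiSpace.

Section AffineMaps.
Variable R : realType.

Record affine_map := AffineMap { lin_part : 'M[R]_3 ; transl_part : 'cV[R]_3 }.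
Implicit Types A B : affine_map.

Definition aff_app A (p : 'cV[R]_3) : 'cV[R]_3 := lin_part A *m p + transl_part A.

Definition aff_one : affine_map := AffineMap 1%:M 0.
Definition aff_mul A B : affine_map :=
  AffineMap (lin_part A *m lin_part B) (lin_part A *m transl_part B + transl_part A).
(* the inverse of A whenever lin_part A is invertible, which holds for isometries *)
Definition aff_inv A : affine_map :=
  AffineMap (invmx (lin_part A)) (- (invmx (lin_part A) *m transl_part A)).
Definition aff_pow A (n : int) : affine_map :=
  match n with
  | Posz k => iter k (aff_mul A) aff_one
  | Negz k => iter k.+1 (aff_mul (aff_inv A)) aff_one
  end.

Definition cyclic_group A : set affine_map := range (aff_pow A).

(* The identity component of O(2,1) consists of the isometries of the form that
   preserve orientation (determinant 1) and time-orientation. *)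
Definition mink_isometry A : Prop :=
  [/\ forall u v : 'cV[R]_3, mink (lin_part A *m u) (lin_part A *m v) = mink u v,
      \det (lin_part A) = 1
    & forall v, future_directed v -> future_directed (lin_part A *m v)].

Definition hyperbolic A : Prop := mink_isometry A /\ 3 < \tr (lin_part A).

Definition fixed_point_free A : Prop := forall p, aff_app A p <> p.

Definition affine_line (L : set 'cV[R]_3) : Prop :=
  exists p u : 'cV[R]_3, u <> 0 /\ L = [set p + t *: u | t in [set: R]].

Definition invariant_line A (L : set 'cV[R]_3) : Prop :=
  affine_line L /\ aff_app A @` L = L.

(* (xm, xp, xo) = (x^-(g), x^+(g), x^o(g)).  The null eigenvectors are only
   determined up to (xm, xp) |-> (s xm, s^-1 xp) with s > 0.  Right-handedness
   is positivity of the determinant with columns xm, xp, xo. *)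
Record eigenframe (g : 'M[R]_3) (lam : R) (xm xp xo : 'cV[R]_3) : Prop := {
  eigenframe_lam : lam < 1 < lam^-1 ;
  eigenframe_xm : g *m xm = lam *: xm ;
  eigenframe_xp : g *m xp = lam^-1 *: xp ;
  eigenframe_xo : g *m xo = xo ;
  eigenframe_xm_null : lightlike xm /\ future_directed xm ;
  eigenframe_xp_null : lightlike xp /\ future_directed xp ;
  eigenframe_null_norm : mink xm xp = -1 ;
  eigenframe_xo_norm : mink xo xo = 1 ;
  eigenframe_right_handed : 0 < \det (row_mx xm (row_mx xp xo) : 'M[R]_3)
}.

(* o is the origin with respect to which coordinates are taken *)
Definition region_B (o xm xp xo : 'cV[R]_3) : set 'cV[R]_3 :=
  [set p | exists pm pp po : R,
     pm * pp < 0 /\ p = o + (pm *: xm + pp *: xp + po *: xo)].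
Definition region_Gplus (o xm xp xo : 'cV[R]_3) : set 'cV[R]_3 :=
  [set p | exists pm pp po : R,
     [/\ 0 <= pm, 0 <= pp & p = o + (pm *: xm + pp *: xp + po *: xo)]].
Definition region_Gminus (o xm xp xo : 'cV[R]_3) : set 'cV[R]_3 :=
  [set p | exists pm pp po : R,
     [/\ pm <= 0, pp <= 0 & p = o + (pm *: xm + pp *: xp + po *: xo)]].

End AffineMaps.

Section Quotient.
Variable R : realType.
Variable Gam : set (affine_map R).

Definition orbit_of (p : 'cV[R]_3) : set 'cV[R]_3 :=
  [set aff_app A p | A in Gam].

(* the points of E/Gam are the orbits *)
Definition orbit_space : Type := set_type (range orbit_of).

Definition quo_proj (p : 'cV[R]_3) : orbit_space := SigSub (mem_set (imageT orbit_of p)).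

(* Paths are functions R -> E/Gam of which only the values on [0, 1] matter.
   Gam is meant to act freely and properly discontinuously, so that the charts
   of E/Gam are the local inverses of quo_proj; a path read in such a chart around
   the time t is a local lift f of the path.  At the endpoints 0 and 1, being
   C^1 means having a C^1 extension to a neighbourhood. *)
Definition local_lift (c : R -> orbit_space) (t : R) (f : R -> 'cV[R]_3) : Prop :=
  exists I : set R,
    [/\ open I, I t,
        forall s, I s -> derivable f s 1 /\ {for s, continuous f^`()%classic}
      & forall s, I s -> 0 <= s <= 1 -> quo_proj (f s) = c s].

Definition C1_path (c : R -> orbit_space) : Prop :=
  forall t, 0 <= t <= 1 -> exists f, local_lift c t f.

(* v represents the tangent vector of c at time t in the chart given by a lift;
   representatives for other lifts differ by the linear part of an element of
   Gam *)
Definition tangent_rep (c : R -> orbit_space) (t : R) (v : 'cV[R]_3) : Prop :=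
  exists2 f, local_lift c t f & v = f^`()%classic t.

Definition all_tangents (K : 'cV[R]_3 -> Prop) (c : R -> orbit_space) : Prop :=
  forall t v, 0 <= t <= 1 -> tangent_rep c t v -> K v.

Definition timelike_curve (c : R -> orbit_space) : Prop :=
  C1_path c /\ all_tangents (@timelike R) c.
Definition spacelike_curve (c : R -> orbit_space) : Prop :=
  C1_path c /\ all_tangents (@spacelike R) c.
Definition causal_curve (c : R -> orbit_space) : Prop :=
  C1_path c /\ all_tangents (@causal R) c.

Definition closed_path (c : R -> orbit_space) : Prop := c 0 = c 1.

Definition path_in (c : R -> orbit_space) (X : set orbit_space) : Prop :=
  forall t, 0 <= t <= 1 -> X (c t).

Definition CTC_region : set orbit_space :=
  [set x | exists c, [/\ timelike_curve c, closed_path c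
                       & exists2 t, 0 <= t <= 1 & c t = x]].

Definition T_region : set 'cV[R]_3 := [set p | CTC_region (quo_proj p)].
Definition F_region : set 'cV[R]_3 := ~` T_region.

(* A C^1 path has a definite causal character if its tangent vectors are all
   spacelike, or all timelike or nonzero lightlike.  A general path has none:
   small loops occur in every open set, with tangents of all types. *)
Definition has_causal_character (c : R -> orbit_space) : Prop :=
  spacelike_curve c \/ causal_curve c.

Definition closed_curves_spacelike (X : set orbit_space) : Prop :=
  forall c, closed_path c -> path_in c X -> has_causal_character c ->
    spacelike_curve c.

End Quotient.

Arguments quo_proj {R} Gam p.
Arguments CTC_region {R} Gam _.

(* Main.v *)
(** In coordinates (p_-, p_+, p_o) centred on C_gamma, gamma acts by
    (p_-, p_+, p_o) |-> (lam p_-, lam^-1 p_+, p_o + a) with a <> 0, and the square norm of a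
    vector is v_o^2 - 2 v_- v_+.  If p_- p_+ < 0, the displacement gamma^n p - p is timelike
    for large n because lam^-n beats n^2 a^2, so a straight segment projects to a closed
    timelike curve.  Conversely, along a causal curve p_- and p_+ are, up to time reversal,
    nondecreasing; a closed curve multiplies them by lam^n and lam^-n, which forces
    p_- p_+ < 0 all along a closed causal curve.  Path lifting is avoided by working with the
    gamma-invariant functions p_- exp (- k p_o) and p_+ exp (k p_o), k = ln lam / a, which
    descend to the quotient. *)
Require Import Defs.
From HB Require Import structures.
From mathcomp Require Import all_boot all_order all_algebra.
From mathcomp Require Import all_classical all_reals all_analysis.
From mathcomp Require Import ring lra.
Import Order.TTheory GRing.Theory Num.Theory.
Import numFieldNormedType.Exports.
Local Open Scope classical_set_scope.
Local Open Scope ring_scope.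

Set Implicit Arguments.
Unset Strict Implicit.
Unset Printing Implicit Defensive.

(** * One-variable calculus on the unit interval *)

Section RealAnalysis.
Context {R : realType}.
Implicit Types (f h : R -> R) (t x : R).

(** Supplies a step length: thanks to the bound [1 / 2], at least one of [t + m] and [t - m] stays
    in [[0, 1]] when [t] does. *)
Lemma exists_lt_min (a b : R) : 0 < a -> 0 < b ->
  exists2 m, 0 < m & [/\ m < a, m < b & m <= 1 / 2].
Proof.
move=> a0 b0; exists (Num.min (Num.min a b) 1 / 2).
  by rewrite divr_gt0// !lt_min a0 b0 ltr01.
have : Num.min (Num.min a b) 1 <= a by rewrite !ge_min lexx.
have : Num.min (Num.min a b) 1 <= b by rewrite !ge_min lexx orbT.
have : Num.min (Num.min a b) 1 <= 1 by rewrite !ge_min lexx orbT.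
have : 0 < Num.min (Num.min a b) 1 by rewrite !lt_min a0 b0 ltr01.
by move: (Num.min (Num.min a b) 1) => M *; split; lra.
Qed.

(** At the endpoints [h] is known on one side only. Since it is derivable, difference quotients
    along increments pointing into [[0, 1]] already determine the derivative, and these quotients
    vanish. *)
Lemma derive_eq0_on_unit_interval h t : derivable h t 1 -> 0 <= t <= 1 ->
  (\forall x \near t, 0 <= x <= 1 -> h x = 0) -> 'D_1 h t = 0.
Proof.
move=> dh t01 h0.
have ht : h t = 0 by apply: (nbhs_singleton h0).
have {}h0 : \forall x \near (0 : R), 0 <= x + t <= 1 -> h (x + t) = 0.
  have : (x + t) @[x --> (0 : R)] --> (0 + t : R) by apply: cvgD; [exact: cvg_id|exact: cvg_cst].
  rewrite add0r => /(_ _ h0); exact.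
have small (e : R) : 0 < e -> exists x, [/\ `|'D_1 h t - x^-1 *: (h (x *: 1 + t) - h t)| < e,
    0 <= x + t <= 1 & (0 <= x + t <= 1 -> h (x + t) = 0)].
  move=> e0.
  move/cvgrPdist_lt : dh => /(_ _ e0)[/= r r0 dcv].
  case: h0 => /= r' r'0 h0.
  have [m m0 [mr mr' mh]] := exists_lt_min r0 r'0.
  exists (if t <= 1 / 2 then m else - m).
  have ne0 : (if t <= 1 / 2 then m else - m) != 0.
    by case: ifP => _; rewrite ?oppr_eq0 gt_eqF.
  have nm : `|if t <= 1 / 2 then m else - m| = m.
    by case: ifP => _; rewrite ?normrN gtr0_norm.
  split.
  - by apply: dcv => //=; rewrite sub0r normrN nm.
  - by move: t01 => /andP[t0 t1]; case: (lerP t (1 / 2)) => ?; apply/andP; split; lra.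
  - by apply: h0; rewrite /= sub0r normrN nm.
apply/eqP; rewrite -normr_eq0; apply/eqP/le_anti; rewrite normr_ge0 andbT.
apply/ler_addgt0Pr => e e0; rewrite add0r.
have [x [xe x01 /(_ x01) hx]] := small _ e0.
by move: xe; rewrite scaler1 hx ht subrr scaler0 subr0 => /ltW.
Qed.

(** The integral from [-1] works; the margins around [[0, 1]] make the derivative two-sided at 0 and
    1. *)
Lemma continuous_primitive f : continuous f ->
  exists F : R -> R, forall x, -1 < x < 2 -> is_derive x 1 F (f x).
Proof.
move=> cf.
exists (fun x => \int[lebesgue_measure]_(t in `[-1, x]) f t) => x /andP[x1 x2].
have [] := @continuous_FTC1_closed R f (-1) x 2 x2 _ x1 (cf x).
  apply: continuous_compact_integrable; first exact: segment_compact.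
  exact: continuous_subspaceT.
by move=> dF <-; rewrite derive1E; exact: derivableP.
Qed.

Lemma is_derive_continuous_within f (f' : R -> R) :
  (forall x, 0 <= x <= 1 -> is_derive x 1 f (f' x)) ->
  {within `[0, 1], continuous f}.
Proof.
by move=> df; apply: derivable_within_continuous => x; rewrite in_itv /= => /df[].
Qed.

Lemma continuous_nonzero_sign f : continuous f ->
  (forall t, 0 <= t <= 1 -> f t != 0) ->
  (forall t, 0 <= t <= 1 -> 0 < f t) \/ (forall t, 0 <= t <= 1 -> f t < 0).
Proof.
move=> cf f0.
have pos0 (a b : R) : 0 <= a -> a <= b -> b <= 1 -> f a * f b > 0.
  move=> a0 ab b1; rewrite ltNge; apply/negP => fab.
  have fa0 : f a != 0 by apply: f0; rewrite a0 (le_trans ab).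
  have fb0 : f b != 0 by apply: f0; rewrite b1 (le_trans a0).
  have [||c] := @IVT R f a b 0 ab.
  - exact: continuous_subspaceT.
  - rewrite ge_min le_max.
    case: (ltgtP (f a) 0) fa0 => //= ? _; case: (ltgtP (f b) 0) fb0 => //= ? _; nra.
  rewrite in_itv /= => /andP[ac cb] fc.
  have := f0 c; rewrite fc eqxx => /(_ _)/negP; apply => //.
  by rewrite (le_trans a0)//= (le_trans cb).
have h t : 0 <= t <= 1 -> 0 < f 0 * f t by move=> /andP[? ?]; exact: pos0.
have f00 : f 0 != 0 by apply: f0; rewrite lexx ler01.
case: (ltrgtP (f 0) 0) f00 => // f00 _; [right|left] => t /h; nra.
Qed.

End RealAnalysis.

(** * Monotone quantities along a loop *)

Section ClosedODE.
Context {R : realType}.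

(** Equal end values squeeze a nondecreasing function to a constant, which forces a zero derivative
    inside. *)
Lemma nondecreasing_flat (h h' : R -> R) :
  (forall t : R, 0 < t < 1 -> is_derive t 1 h (h' t)) ->
  {within `[0, 1], continuous h} -> (forall t : R, 0 < t < 1 -> 0 <= h' t) ->
  (forall x y : R, 0 <= x -> x <= y -> y <= 1 -> h x <= h y) /\
  (h 0 = h 1 -> forall c : R, 0 < c < 1 -> h' c = 0).
Proof.
move=> dh ch h'0.
have mono (x y : R) : 0 <= x -> x <= y -> y <= 1 -> h x <= h y.
  move=> x0 xy y1; apply: (@ger0_derive1_le_cc R h 0 1) => //.
  - by move=> z; rewrite in_itv /= => /dh[].
  - by move=> z; rewrite in_itv /= => z01; rewrite derive1E; have [_ ->] := dh _ z01; exact: h'0.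
  - by rewrite in_itv /= x0 (le_trans xy).
  - by rewrite in_itv /= y1 (le_trans x0).
split => // h01 c /[dup] c01 /andP[c0 c1].
have [_ <-] := dh _ c01.
have -> : 'D_1 h c = 'D_1 (cst (h 0)) c.
  apply: near_eq_derive.
  have : c \in `]0, 1[ by rewrite in_itv /= c0.
  move=> /near_in_itvoo; apply: filterS.
  move=> x; rewrite in_itv /= => /andP[x0 x1].
  by apply/le_anti; rewrite {1}h01 !mono// ltW.
exact: derive_cst.
Qed.

(* The integrating factor [expR (k * T)], with [T' = N], replaces the lift of the
   loop to the universal cover: it turns U and V into nondecreasing functions which
   the loop multiplies by [q] and [q^-1]. *)
Lemma closed_ode_sign (k : R) (U V D E N : R -> R) :
  continuous U -> continuous V -> continuous D -> continuous E -> continuous N ->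
  (forall t : R, 0 < t < 1 -> is_derive t 1 U (D t - k * N t * U t)) ->
  (forall t : R, 0 < t < 1 -> is_derive t 1 V (E t + k * N t * V t)) ->
  (forall t : R, 0 <= t <= 1 -> N t ^+ 2 <= 2 * (D t * E t)) ->
  (forall t : R, 0 <= t <= 1 -> D t + E t != 0) ->
  U 0 = U 1 -> V 0 = V 1 ->
  forall t : R, 0 <= t <= 1 -> U t * V t < 0.
Proof.
move=> cU cV cD cE cN dU dV NDE DE0 U01 V01.
(* Negating [U], [V], [D], [E] together preserves every hypothesis and the product [U t * V t], so
   the constant sign of [D + E] may be taken positive. *)
wlog DEpos : U V D E cU cV cD cE dU dV NDE DE0 U01 V01 /
    forall t : R, 0 <= t <= 1 -> 0 < D t + E t.
  have [||DEp|DEn] := @continuous_nonzero_sign R (fun t => D t + E t).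
  - by move=> t; apply: cvgD; [exact: cD|exact: cE].
  - exact: DE0.
  - by move/(_ U V D E); apply.
  move/(_ (\- U) (\- V) (\- D) (\- E)) => H t t01; rewrite -mulrNN; apply: H => //.
  - by move=> x; apply: cvgN; exact: cU.
  - by move=> x; apply: cvgN; exact: cV.
  - by move=> x; apply: cvgN; exact: cD.
  - by move=> x; apply: cvgN; exact: cE.
  - move=> x x01; have := is_deriveN (dU _ x01).
    move=> /is_derive_eq; apply; rewrite /=; ring.
  - move=> x x01; have := is_deriveN (dV _ x01).
    move=> /is_derive_eq; apply; rewrite /=; ring.
  - by move=> x x01; rewrite mulrNN; exact: NDE.
  - by move=> x x01; rewrite -opprD oppr_eq0; exact: DE0.
  - by rewrite /= U01.
  - by rewrite /= V01.
  - by move=> x x01; rewrite -opprD oppr_gt0; exact: DEn.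
have oo_cc (t : R) : 0 < t < 1 -> 0 <= t <= 1 by move=> /andP[*]; rewrite !ltW.
(* The product [D t * E t] dominates a square, so it is nonnegative; with a positive sum, neither
   factor is negative. *)
have D0 (t : R) : 0 <= t <= 1 -> 0 <= D t.
  by move=> t01; have := NDE _ t01; have := DEpos _ t01; nra.
have E0 (t : R) : 0 <= t <= 1 -> 0 <= E t.
  by move=> t01; have := NDE _ t01; have := DEpos _ t01; nra.
have [T dT] := continuous_primitive cN.
have dTcc (t : R) : 0 <= t <= 1 -> is_derive t 1 T (N t).
  by move=> /andP[? ?]; apply: dT; apply/andP; split; lra.
pose e s t := expR (s * T t).
have e_gt0 s t : 0 < e s t by exact: expR_gt0.
have de s (t : R) : 0 <= t <= 1 -> is_derive t 1 (e s) (e s t * (s * N t)).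
  move=> t01; apply: (is_derive1_comp (g := fun x => s * T x)).
  exact: is_deriveZ (dTcc _ t01).
have ce s : {within `[0, 1], continuous (e s)}.
  exact: is_derive_continuous_within (de s).
(* The derivative of the integrating factor cancels the terms in [k * N], leaving [D] and [E] times
   positive exponentials. *)
pose m t := U t * e k t.
pose p t := V t * e (- k) t.
have dm (t : R) : 0 < t < 1 -> is_derive t 1 m (e k t * D t).
  move=> t01; have := is_deriveM (dU _ t01) (de k _ (oo_cc _ t01)).
  move=> /is_derive_eq; apply; rewrite /= /GRing.scale /=; ring.
have dp (t : R) : 0 < t < 1 -> is_derive t 1 p (e (- k) t * E t).
  move=> t01; have := is_deriveM (dV _ t01) (de (- k) _ (oo_cc _ t01)).
  move=> /is_derive_eq; apply; rewrite /= /GRing.scale /=; ring.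
have cm : {within `[0, 1], continuous m}.
  move=> x; apply: (@continuousM _ (subspace _)); [exact: continuous_subspaceT|exact: ce].
have cp : {within `[0, 1], continuous p}.
  move=> x; apply: (@continuousM _ (subspace _)); [exact: continuous_subspaceT|exact: ce].
have m'0 (t : R) : 0 < t < 1 -> 0 <= e k t * D t.
  by move=> t01; apply: mulr_ge0; [exact: ltW|exact/D0/oo_cc].
have p'0 (t : R) : 0 < t < 1 -> 0 <= e (- k) t * E t.
  by move=> t01; apply: mulr_ge0; [exact: ltW|exact/E0/oo_cc].
have [mm mflat] := nondecreasing_flat dm cm m'0.
have [pp pflat] := nondecreasing_flat dp cp p'0.
have eV t : e (- k) t = (e k t)^-1 by rewrite /e mulNr expRN.
(* Otherwise [m] and [p] would have equal end values, hence be flat, and [D] and [E] would vanish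
   together at [1 / 2]. *)
have e01 : e k 0 != e k 1.
  apply/eqP => e01.
  have half : 0 < (1 / 2 : R) < 1 by apply/andP; split; lra.
  have m01 : m 0 = m 1 by rewrite /m e01 U01.
  have p01 : p 0 = p 1 by rewrite /p !eV e01 V01.
  have /eqP := mflat m01 _ half; rewrite mulf_eq0 gt_eqF//= => /eqP Dh.
  have /eqP := pflat p01 _ half; rewrite mulf_eq0 gt_eqF//= => /eqP Eh.
  by have := DE0 _ (oo_cc _ half); rewrite Dh Eh addr0 eqxx.
(* By the mean value theorem, [N] is nonzero somewhere because [T 0] and [T 1] differ. There [D] and
   [E] are both positive, so [m] and [p] grow strictly from 0 to 1. *)
have [c c01 Nc] : exists2 c, 0 < c < 1 & N c != 0.
  have [||c] := @MVT R T N 0 1 ltr01.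
  - by move=> x; rewrite in_itv /= => /oo_cc/dTcc.
  - exact: is_derive_continuous_within dTcc.
  rewrite in_itv /= subr0 mulr1 => c01 Tc; exists c => //.
  apply: contra e01; rewrite -Tc subr_eq0 => /eqP T01.
  by rewrite /e T01.
have := NDE _ (oo_cc _ c01); have N2 : 0 < N c ^+ 2 by rewrite exprn_even_gt0.
move=> NDEc.
have Dc : 0 < D c.
  have := D0 _ (oo_cc _ c01); have := E0 _ (oo_cc _ c01); nra.
have Ec : 0 < E c by nra.
have m01 : m 0 < m 1.
  rewrite lt_neqAle mm// andbT; apply/eqP => /mflat/(_ _ c01)/eqP.
  by rewrite mulf_eq0 !gt_eqF.
have p01 : p 0 < p 1.
  rewrite lt_neqAle pp// andbT; apply/eqP => /pflat/(_ _ c01)/eqP.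
  by rewrite mulf_eq0 !gt_eqF.
move=> t /andP[t0 t1].
have mt0 := mm _ _ (lexx 0) t0 t1; have mt1 := mm _ _ t0 t1 (lexx 1).
have pt0 := pp _ _ (lexx 0) t0 t1; have pt1 := pp _ _ t0 t1 (lexx 1).
have -> : U t * V t = m t * p t.
  by rewrite /m /p eV; field; rewrite gt_eqF.
have m0E : m 0 = U 1 * e k 0 by rewrite /m U01.
have p0E : p 0 = V 1 * e (- k) 0 by rewrite /p V01.
have m1E : m 1 = U 1 * e k 1 by [].
have p1E : p 1 = V 1 * e (- k) 1 by [].
have := e_gt0 k 0; have := e_gt0 k 1; have := e_gt0 (- k) 0; have := e_gt0 (- k) 1.
move: (m 0) (m 1) (p 0) (p 1) (m t) (p t) m01 p01 mt0 mt1 pt0 pt1 m0E p0E m1E p1E.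
move=> m0 m1 p0 p1 x y m01 p01 ? ? ? ? m0E p0E m1E p1E f1 f0 g1 g0.
(* The increment [U 1 * (e k 1 - e k 0)] of [m] is positive, which gives the sign of [U 1]; [V 1]
   has the opposite sign, as [e (- k)] is the inverse of [e k]. Monotonicity then carries the signs
   of [m] and [p] from an endpoint to [t]. *)
case: (ltgtP (e k 0) (e k 1)) e01 => // e01 _.
- have f01 : e (- k) 1 < e (- k) 0 by rewrite !eV ltf_pV2 ?posrE.
  have U1 : 0 < U 1 by nra.
  have V1 : V 1 < 0 by nra.
  have : 0 < m0 by nra.
  have : p1 < 0 by nra.
  nra.
- have f01 : e (- k) 0 < e (- k) 1 by rewrite !eV ltf_pV2 ?posrE.
  have U1 : U 1 < 0 by nra.
  have V1 : 0 < V 1 by nra.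
  have : m1 < 0 by nra.
  have : 0 < p0 by nra.
  nra.
Qed.

End ClosedODE.

(** * The Lorentz form and causal vectors *)

Section Minkowski.
Context {R : realType}.
Implicit Types u v w : 'cV[R]_3.

Lemma minkC u v : mink u v = mink v u.
Proof. by rewrite /mink; ring. Qed.

Lemma minkDl u v w : mink (u + v) w = mink u w + mink v w.
Proof. by rewrite /mink !mxE; ring. Qed.

Lemma minkZl (c : R) u w : mink (c *: u) w = c * mink u w.
Proof. by rewrite /mink !mxE; ring. Qed.

Lemma minkNl u w : mink (- u) w = - mink u w.
Proof. by rewrite /mink !mxE; ring. Qed.

Lemma minkBl u v w : mink (u - v) w = mink u w - mink v w.
Proof. by rewrite /mink !mxE; ring. Qed.

Lemma minkDr u v w : mink w (u + v) = mink w u + mink w v.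
Proof. by rewrite /mink !mxE; ring. Qed.

Lemma minkZr (c : R) u w : mink w (c *: u) = c * mink w u.
Proof. by rewrite /mink !mxE; ring. Qed.

Lemma causal_mink_le0 v : causal v -> mink v v <= 0.
Proof. by case=> [/ltW//|[-> _]]. Qed.

Lemma causal_neq0 v : causal v -> v != 0.
Proof.
case=> [|[_ /eqP//]]; rewrite /timelike => vv; apply: contraTneq vv => ->.
by rewrite /mink !mxE !mulr0 addr0 subr0 ltxx.
Qed.

Lemma future_directedN v : past_directed v -> future_directed (- v).
Proof.
move=> [cv v2]; split; last by rewrite mxE oppr_gt0.
have NN : mink (- v) (- v) = mink v v by rewrite /mink !mxE; ring.
case: cv => [tv|[lv v0]]; [left|right]; rewrite /timelike /lightlike NN //.
by split => // /eqP; rewrite oppr_eq0 => /eqP.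
Qed.

(** By Cauchy-Schwarz the spatial pairing is at most the product of the spatial lengths, each
    bounded by a positive time coordinate. *)
Lemma future_directed_mink_le0 v w :
  future_directed v -> future_directed w -> mink v w <= 0.
Proof.
move=> [/causal_mink_le0 vv v2] [/causal_mink_le0 ww w2].
rewrite /mink subr_le0 in vv ww *.
move: (v 0 0) (v 1 0) (v 2%:R 0) (w 0 0) (w 1 0) (w 2%:R 0) vv ww v2 w2.
move=> a b c x y z vv ww c0 z0.
have cs : (a * x + b * y) ^+ 2 <= (c * z) ^+ 2.
  apply: (@le_trans _ _ ((a * a + b * b) * (x * x + y * y))).
    (* Lagrange's identity: the two sides differ by exactly this square. *)
    by have := sqr_ge0 (a * y - b * x); nra.
  rewrite expr2 mulrACA; apply: ler_pM => //; nra.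
have cz : 0 < c * z by rewrite mulr_gt0.
by rewrite leNgt; apply/negP => /[dup]; nra.
Qed.

End Minkowski.

(** * Coordinates in the eigenframe *)

Section Frame.
Context {R : realType}.
Variables (g : 'M[R]_3) (lam : R) (xm xp xo : 'cV[R]_3).
Hypothesis g_mink : forall u v, mink (g *m u) (g *m v) = mink u v.
Hypothesis fr : eigenframe g lam xm xp xo.

Lemma frame_lam_gt0 : 0 < lam.
Proof.
have /andP[_ h] := eigenframe_lam fr.
by rewrite -invr_gt0 (lt_trans ltr01 h).
Qed.

Lemma frame_lam_lt1 : lam < 1.
Proof. by have /andP[] := eigenframe_lam fr. Qed.

(** Invariance of the form multiplies this pairing by the product of the two eigenvalues, here
    [lam], which is not 1. *)
Lemma frame_mink_mo : mink xm xo = 0.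
Proof.
have := g_mink xm xo; rewrite (eigenframe_xm fr) (eigenframe_xo fr) minkZl => h.
have := frame_lam_lt1; nra.
Qed.

Lemma frame_mink_po : mink xp xo = 0.
Proof.
have := g_mink xp xo; rewrite (eigenframe_xp fr) (eigenframe_xo fr) minkZl => h.
by have /andP[_] := eigenframe_lam fr; nra.
Qed.

(** Pairings replace coordinates from here on. As [xm] and [xp] are null with [mink xm xp = -1], the
    [xm] coefficient is minus the pairing with [xp], and vice versa. *)
Lemma frame_mink_comb (a b c : R) : let v := a *: xm + b *: xp + c *: xo in
  [/\ mink v xp = - a, mink v xm = - b & mink v xo = c].
Proof.
have [mm _] := eigenframe_xm_null fr; have [pp _] := eigenframe_xp_null fr.
rewrite /lightlike in mm pp.
have mp := eigenframe_null_norm fr; have oo := eigenframe_xo_norm fr.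
have mo := frame_mink_mo; have po := frame_mink_po.
rewrite /= !minkDl !minkZl (minkC xo xp) (minkC xo xm) (minkC xp xm).
by rewrite mp mm pp mo po oo; split; ring.
Qed.

(** Right-handedness makes the frame matrix invertible, so the frame spans; the coefficients are
    then read off by pairing. *)
Lemma frame_decomp v : v = - mink v xp *: xm + - mink v xm *: xp + mink v xo *: xo.
Proof.
suff [a [b [c ->]]] : exists a b c, v = a *: xm + b *: xp + c *: xo.
  by have [-> -> ->] := frame_mink_comb a b c; rewrite !opprK.
pose M : 'M[R]_(3, 1 + (1 + 1)) := row_mx xm (row_mx xp xo).
have MU : (M : 'M[R]_3) \in unitmx.
  by rewrite unitmxE unitfE gt_eqF// (eigenframe_right_handed fr).
pose w : 'cV[R]_(1 + (1 + 1)) := invmx (M : 'M[R]_3) *m v.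
have -> : v = M *m w by rewrite mulKVmx.
exists (usubmx w 0 0), (usubmx (dsubmx w) 0 0), (dsubmx (dsubmx w) 0 0).
rewrite -{1}[w]vsubmxK -{1}[dsubmx w]vsubmxK /M !mul_row_col addrA.
by rewrite -!mul_mx_scalar -!mx11_scalar.
Qed.

Lemma frame_mink_sqr v :
  mink v v = mink v xo ^+ 2 - 2 * (mink v xp * mink v xm).
Proof.
rewrite {1}(frame_decomp v) minkC minkDr minkDr !minkZr; ring.
Qed.

Lemma frame_eq0 v : mink v xp = 0 -> mink v xm = 0 -> mink v xo = 0 -> v = 0.
Proof.
by move=> h1 h2 h3; rewrite (frame_decomp v) h1 h2 h3 oppr0 !scale0r !addr0.
Qed.

(** Invariance moves [g] onto the frame vector, so a pairing with an eigenvector scales by the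
    inverse of its eigenvalue. *)
Lemma frame_mink_mul v :
  [/\ mink (g *m v) xp = lam * mink v xp,
      mink (g *m v) xm = lam^-1 * mink v xm & mink (g *m v) xo = mink v xo].
Proof.
have l0 : lam != 0 by rewrite gt_eqF// frame_lam_gt0.
split.
- by rewrite -(g_mink v xp) (eigenframe_xp fr) minkZr mulrA divff ?mul1r.
- by rewrite -(g_mink v xm) (eigenframe_xm fr) minkZr mulrA mulVf ?mul1r.
- by rewrite -(g_mink v xo) (eigenframe_xo fr).
Qed.

End Frame.

(** * Powers of [gam] in frame coordinates, and orbits *)

Section CyclicAction.
Context {R : realType}.
Variables (gam : affine_map R) (lam : R) (xm xp xo o : 'cV[R]_3) (a : R).
Hypothesis gam_iso : mink_isometry gam.
Hypothesis fr : eigenframe (lin_part gam) lam xm xp xo.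
Hypothesis gam_o : aff_app gam o = o + a *: xo.

Let g_mink u v : mink (lin_part gam *m u) (lin_part gam *m v) = mink u v.
Proof. by have [h _ _] := gam_iso; apply: h. Qed.

Let lam0 : lam != 0. Proof. by rewrite gt_eqF// (frame_lam_gt0 fr). Qed.

Lemma aff_app_mul A B (p : 'cV[R]_3) : aff_app (aff_mul A B) p = aff_app A (aff_app B p).
Proof. by rewrite /aff_app /= mulmxDr mulmxA addrA. Qed.

Lemma aff_app_inv p : aff_app gam (aff_app (aff_inv gam) p) = p.
Proof.
have gU : lin_part gam \in unitmx.
  by have [_ d _] := gam_iso; rewrite unitmxE d unitr1.
by rewrite /aff_app /= mulmxDr mulmxN !mulKVmx// subrK.
Qed.

Lemma aff_app_sub p : aff_app gam p - o = lin_part gam *m (p - o) + a *: xo.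
Proof.
have -> : aff_app gam p = lin_part gam *m (p - o) + aff_app gam o.
  by rewrite /aff_app mulmxBr addrA subrK.
by rewrite gam_o (addrC o) addrA addrK.
Qed.

Lemma aff_app_coords p :
  [/\ mink (aff_app gam p - o) xp = lam * mink (p - o) xp,
      mink (aff_app gam p - o) xm = lam^-1 * mink (p - o) xm
    & mink (aff_app gam p - o) xo = mink (p - o) xo + a].
Proof.
rewrite aff_app_sub !(minkDl _ (a *: xo)) !minkZl (minkC xo xp) (minkC xo xm).
rewrite (frame_mink_mo g_mink fr) (frame_mink_po g_mink fr) (eigenframe_xo_norm fr).
have [-> -> ->] := frame_mink_mul g_mink fr (p - o).
by rewrite !mulr0 !addr0 mulr1.
Qed.

Lemma aff_inv_coords p :
  [/\ mink (aff_app (aff_inv gam) p - o) xp = lam^-1 * mink (p - o) xp,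
      mink (aff_app (aff_inv gam) p - o) xm = lam * mink (p - o) xm
    & mink (aff_app (aff_inv gam) p - o) xo = mink (p - o) xo - a].
Proof.
have := aff_app_coords (aff_app (aff_inv gam) p); rewrite aff_app_inv => -[-> -> ->].
by rewrite !mulrA mulVf// divff// !mul1r addrK.
Qed.

Lemma aff_pow_coords n p :
  [/\ mink (aff_app (aff_pow gam n) p - o) xp = lam ^ n * mink (p - o) xp,
      mink (aff_app (aff_pow gam n) p - o) xm = lam ^ (- n) * mink (p - o) xm
    & mink (aff_app (aff_pow gam n) p - o) xo = mink (p - o) xo + n%:~R * a].
Proof.
case: n => k; rewrite /aff_pow.
- elim: k => [|k [IH1 IH2 IH3]].
    by rewrite /aff_app /= mul1mx addr0 oppr0 !expr0z !mul1r mul0r addr0.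
  rewrite iterS aff_app_mul; have [-> -> ->] :=
    aff_app_coords (aff_app (iter k (aff_mul gam) (aff_one R)) p).
  rewrite IH1 IH2 IH3 !mulrA -[k.+1]addn1 PoszD opprD !expfzDr// exprN1.
  by rewrite expr1z intrD mulrDl mul1r addrA; split; [congr (_ * _);
    rewrite mulrC|congr (_ * _); rewrite mulrC|].
(* [Negz k] stands for [- (k + 1)], so the base case already applies the inverse once. *)
- elim: k => [|k [IH1 IH2 IH3]].
    rewrite iterS aff_app_mul; have [-> -> ->] :=
      aff_inv_coords (aff_app (iter 0 (aff_mul (aff_inv gam)) (aff_one R)) p).
    rewrite /aff_app /= mul1mx addr0 NegzE opprK.
    by rewrite exprN1 expr1z mulN1r.
  rewrite iterS aff_app_mul; have [-> -> ->] :=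
    aff_inv_coords (aff_app (iter k.+1 (aff_mul (aff_inv gam)) (aff_one R)) p).
  rewrite IH1 IH2 IH3 !mulrA.
  have -> : Negz k.+1 = Negz k - 1 by rewrite !NegzE -[k.+2]addn1 PoszD opprD.
  rewrite opprB [1 - _]addrC !expfzDr// exprN1.
  rewrite expr1z intrD mulrDl mulN1r addrA; split; [congr (_ * _); rewrite mulrC|congr (_ * _);
    rewrite mulrC|]; done.
Qed.

Lemma frame_point_inj p q : mink (p - o) xp = mink (q - o) xp ->
  mink (p - o) xm = mink (q - o) xm -> mink (p - o) xo = mink (q - o) xo -> p = q.
Proof.
move=> h1 h2 h3; apply/eqP; rewrite -subr_eq0; apply/eqP.
have -> : p - q = (p - o) - (q - o) by rewrite opprB addrA subrK.
by apply: (frame_eq0 g_mink fr); rewrite minkBl ?h1 ?h2 ?h3 subrr.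
Qed.

Let Gam := cyclic_group gam.

Lemma quo_proj_eqP p q : quo_proj Gam p = quo_proj Gam q <->
  exists n, q = aff_app (aff_pow gam n) p.
Proof.
split=> [pq|[n ->]].
  have : orbit_of Gam q q.
    by exists (aff_pow gam 0); [exists 0|rewrite /aff_app /= mul1mx addr0].
  have -> : orbit_of Gam q = orbit_of Gam p by exact: (congr1 (fun x => set_val x) (esym pq)).
  by case=> A [n _ <-] <-; exists n.
apply: val_inj; rewrite /=.
(* The law of exponents is checked on points by comparing coordinates, which avoids mixing iterates
   of [gam] and of its inverse. *)
have shift m k : aff_app (aff_pow gam m) (aff_app (aff_pow gam k) p) =
  aff_app (aff_pow gam (m + k)) p.
  have [a1 a2 a3] := aff_pow_coords m (aff_app (aff_pow gam k) p).
  have [b1 b2 b3] := aff_pow_coords k p.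
  have [c1 c2 c3] := aff_pow_coords (m + k) p.
  apply: frame_point_inj.
  - by rewrite a1 b1 c1 expfzDr// mulrA.
  - by rewrite a2 b2 c2 opprD expfzDr// mulrA.
  - by rewrite a3 b3 c3 intrD mulrDl [_ * a + _ * a]addrC addrA.
apply/seteqP; split => x [A [m _ <-] <-].
  exists (aff_pow gam (m - n)); first by exists (m - n).
  by rewrite shift subrK.
by exists (aff_pow gam (m + n)); [exists (m + n)|rewrite shift].
Qed.

End CyclicAction.

(** * Retraction of the line onto the unit interval *)

Section Clamp.
Context {R : realType}.

(** Paths carry information on [[0, 1]] only; evaluating at clamped times yields functions
    continuous on the whole line. *)
Definition clamp (t : R) : R := Num.max 0 (Num.min t 1).

Lemma clamp_itv t : 0 <= clamp t <= 1.
Proof. by rewrite /clamp le_max lexx /= ge_max ler01 /= ge_min lexx orbT. Qed.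

Lemma clamp_id t : 0 <= t <= 1 -> clamp t = t.
Proof. by move=> /andP[t0 t1]; rewrite /clamp min_l// max_r. Qed.

Lemma clamp_continuous : continuous clamp.
Proof.
move=> t; apply: (@continuous_max R R (cst 0) (id \min cst 1)); first exact: cvg_cst.
by apply: continuous_min; [exact: cvg_id|exact: cvg_cst].
Qed.

End Clamp.

(** * Derivatives of pairings with a fixed vector *)

Section MinkDerive.
Context {R : realType}.
Implicit Types (f : R -> 'cV[R]_3) (s : R) (w : 'cV[R]_3).

Lemma scale_regE (x y : R) : x *: y = x * y.
Proof. by []. Qed.

Lemma is_derive_mink f s o w : derivable f s 1 ->
  is_derive s 1 (fun x => mink (f x - o) w) (mink (f^`()%classic s) w).
Proof.
move=> df.
have d i : is_derive s 1 (fun x => f x i 0) (f^`()%classic s i 0).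
  rewrite derive1E (derive_mx df) mxE.
  by apply: derivableP; move/derivable_mxP : df; apply.
have := is_deriveB (is_deriveB (is_deriveD (is_deriveZ (w 0 0) (d 0))
  (is_deriveZ (w 1 0) (d 1))) (is_deriveZ (w 2%:R 0) (d 2%:R)))
  (is_derive_cst (mink o w) s 1).
set F := (X in is_derive s 1 X _); have -> : F = (fun x => mink (f x - o) w).
  by apply/funext => x; rewrite /F /mink !mxE !fctE /= !scale_regE; ring.
by move=> /is_derive_eq; apply; rewrite /mink ?scale_regE; ring.
Qed.

Lemma continuous_mink f s w : {for s, continuous f} ->
  {for s, continuous (fun x => mink (f x) w)}.
Proof.
move=> cf.
have c i : {for s, continuous (fun x => f x i 0)}.
  exact: (continuous_comp cf (@coord_continuous _ _ _ i 0 (f s))).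
apply: cvgB; first apply: cvgD; apply: cvgM; by [exact: c|exact: cvg_cst].
Qed.

End MinkDerive.

(** * Local lifts of paths in the quotient *)

Section LocalLifts.
Context {R : realType} (Gam : set (affine_map R)).
Implicit Types (c : R -> orbit_space Gam) (s t : R) (f : R -> 'cV[R]_3).

Lemma local_lift_near c t f : local_lift c t f ->
  \forall s \near t, local_lift c s f.
Proof.
move=> [I [oI It df If]]; have : nbhs t I by exact: open_nbhs_nbhs.
by apply: filterS => s Is; exists I.
Qed.

Lemma local_lift_eq c t f : local_lift c t f -> 0 <= t <= 1 -> quo_proj Gam (f t) = c t.
Proof. by move=> [I [_ It _ /(_ _ It)]]. Qed.

Lemma local_lift_derivable c t f : local_lift c t f -> derivable f t 1.
Proof. by move=> [I [_ It /(_ _ It)[]]]. Qed.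

Lemma local_lift_continuous c t f : local_lift c t f -> {for t, continuous f}.
Proof.
by move=> /local_lift_derivable /derivable1_diffP /differentiable_continuous.
Qed.

Lemma local_lift_continuous_derive1 c t f :
  local_lift c t f -> {for t, continuous f^`()%classic}.
Proof. by move=> [I [_ It /(_ _ It)[]]]. Qed.

(** The family [L] may jump with [t]. Near a given time, however, the single lift [L t] still
    serves, and invariance of [q] identifies the function with [q (L t)] composed with [clamp]. *)
Lemma lift_invariant_continuous c (L : R -> R -> 'cV[R]_3)
    (q : (R -> 'cV[R]_3) -> R -> R) :
  (forall t, local_lift c (clamp t) (L t)) ->
  (forall f1 f2 s, 0 <= s <= 1 -> local_lift c s f1 -> local_lift c s f2 ->
    q f1 s = q f2 s) ->
  (forall f s, local_lift c s f -> {for s, continuous (q f)}) ->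
  continuous (fun t => q (L t) (clamp t)).
Proof.
move=> lL qinv qc t.
have cq : {for t, continuous (q (L t) \o clamp)}.
  by apply: continuous_comp; [exact: clamp_continuous|exact: qc].
apply: cvg_trans cq; apply: near_eq_cvg.
have ls : \forall s \near t, local_lift c (clamp s) (L t).
  exact: (@clamp_continuous R t _ (local_lift_near (lL t))).
apply: (filterS _ ls) => s {}ls /=; apply: qinv; [exact: clamp_itv|exact: ls|exact: lL].
Qed.

End LocalLifts.

(** * Closed causal curves *)

Section CausalLoops.
Context {R : realType}.
Variables (gam : affine_map R) (lam : R) (xm xp xo o : 'cV[R]_3) (a : R).
Hypothesis gam_iso : mink_isometry gam.
Hypothesis fr : eigenframe (lin_part gam) lam xm xp xo.
Hypothesis gam_o : aff_app gam o = o + a *: xo.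
Hypothesis a0 : a != 0.

Notation Gam := (cyclic_group gam).

Let g_mink u v : mink (lin_part gam *m u) (lin_part gam *m v) = mink u v.
Proof. by have [h _ _] := gam_iso; apply: h. Qed.

(** Two lifts differ at each time by a power of [gam]. The exponent is locally constant, so the
    relation between positions can be differentiated into one between velocities. *)
Lemma lift_agree (c : R -> orbit_space Gam) f1 f2 (s : R) : 0 <= s <= 1 ->
  local_lift c s f1 -> local_lift c s f2 ->
  exists n : int,
  [/\ mink (f2 s - o) xp = lam ^ n * mink (f1 s - o) xp,
      mink (f2 s - o) xm = lam ^ (- n) * mink (f1 s - o) xm
    & mink (f2 s - o) xo = mink (f1 s - o) xo + n%:~R * a] /\
  [/\ mink (f2^`()%classic s) xp = lam ^ n * mink (f1^`()%classic s) xp,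
      mink (f2^`()%classic s) xm = lam ^ (- n) * mink (f1^`()%classic s) xm
    & mink (f2^`()%classic s) xo = mink (f1^`()%classic s) xo].
Proof.
move=> s01 l1 l2.
have ex x : 0 <= x <= 1 -> local_lift c x f1 -> local_lift c x f2 ->
    exists n, f2 x = aff_app (aff_pow gam n) (f1 x).
  move=> x01 lx1 lx2; apply/(quo_proj_eqP gam_iso fr gam_o).
  by rewrite (local_lift_eq lx1)// (local_lift_eq lx2).
have [n fn] := ex _ s01 l1 l2; exists n.
have near_n : \forall x \near s, 0 <= x <= 1 -> f2 x = aff_app (aff_pow gam n) (f1 x).
  (* This difference is continuous and, at times of [[0, 1]], an integer multiple of [a]; a
     variation below [|a|] leaves the integer unchanged. *)
  pose z x := mink (f2 x - o) xo - mink (f1 x - o) xo.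
  have cz : {for s, continuous z}.
    by apply: cvgB; apply: continuous_mink; apply: cvgB;
      by [exact: local_lift_continuous l2|exact: local_lift_continuous l1|exact: cvg_cst].
  have a_gt0 : 0 < `|a| by rewrite normr_gt0.
  move/cvgrPdist_lt : cz => /(_ _ a_gt0) nz.
  near=> x => x01.
  have lx1 : local_lift c x f1 by near: x; exact: local_lift_near.
  have lx2 : local_lift c x f2 by near: x; exact: local_lift_near.
  have : `|z s - z x| < `|a| by near: x.
  have [m fm] := ex _ x01 lx1 lx2; rewrite fm.
  rewrite /z fn fm.
  have [_ _ ->] := aff_pow_coords gam_iso fr gam_o n (f1 s).
  have [_ _ ->] := aff_pow_coords gam_iso fr gam_o m (f1 x).
  rewrite ![_ + _%:~R * a]addrC !addrK -mulrBl normrM -intrB.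
  rewrite gtr_pMl// -intr_norm -[1]/(1%:~R) ltr_int -[1]add0r ltzD1 normr_le0 subr_eq0.
  by move=> /eqP ->.
have [b1 b2 b3] := aff_pow_coords gam_iso fr gam_o n (f1 s).
rewrite fn b1 b2 b3; split => //.
have d1 w := is_derive_mink o w (local_lift_derivable l1).
have d2 w := is_derive_mink o w (local_lift_derivable l2).
(* The identity holds only at times in [[0, 1]], hence on one side when [s] is an endpoint;
   [derive_eq0_on_unit_interval] handles that. *)
have key w (k b : R) : (\forall x \near s, 0 <= x <= 1 ->
      mink (f2 x - o) w = k * mink (f1 x - o) w + b) ->
    mink (f2^`()%classic s) w = k * mink (f1^`()%classic s) w.
  move=> E.
  have dh := is_deriveB (d2 w) (is_deriveD (is_deriveZ k (d1 w)) (is_derive_cst b s 1)).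
  have [dh1 dh2] := dh.
  apply/eqP; rewrite -subr_eq0; apply/eqP.
  rewrite -scale_regE -[k *: _]addr0 -dh2.
  apply: derive_eq0_on_unit_interval => //.
  apply: filterS E => x E /E.
  by rewrite !fctE /= scale_regE => ->; rewrite subrr.
have nE : \forall x \near s, 0 <= x <= 1 ->
  [/\ mink (f2 x - o) xp = lam ^ n * mink (f1 x - o) xp + 0,
      mink (f2 x - o) xm = lam ^ (- n) * mink (f1 x - o) xm + 0
    & mink (f2 x - o) xo = 1 * mink (f1 x - o) xo + n%:~R * a].
  apply: filterS near_n => x fx /fx ->; rewrite !addr0 mul1r.
  exact: (aff_pow_coords gam_iso fr gam_o n (f1 x)).
split.
- by apply: (key _ _ 0); apply: filterS nE => x fx /fx[].
- by apply: (key _ _ 0); apply: filterS nE => x fx /fx[].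
- rewrite -[RHS]mul1r; apply: (key _ _ (n%:~R * a)).
  by apply: filterS nE => x fx /fx[].
Unshelve. all: by end_near.
Qed.

(** The rate at which advancing the [xo] coordinate by [a] multiplies [expR (k * _)] by [lam]. *)
Let k := ln lam / a.

Let expR_period (n : int) : expR (k * (n%:~R * a)) = lam ^ n.
Proof.
have lam_gt0 := frame_lam_gt0 fr.
have -> : k * (n%:~R * a) = n%:~R * ln lam by rewrite /k; field.
case: n => m; first by rewrite expRM_natl lnK ?posrE.
by rewrite NegzE intrN mulNr expRN expRM_natl lnK ?posrE.
Qed.

Let expR_shift (n : int) z : expR (- (k * (z + n%:~R * a))) = lam ^ (- n) * expR (- (k * z)).
Proof. by rewrite -expR_period -expRD intrN; congr expR; ring. Qed.

Let expR_shift' (n : int) z : expR (k * (z + n%:~R * a)) = lam ^ n * expR (k * z).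
Proof. by rewrite -expR_period -expRD; congr expR; ring. Qed.

(* All unchanged when the lift f is composed with a power of [gam]. *)
Let liftU (f : R -> 'cV[R]_3) s := mink (f s - o) xp * expR (- (k * mink (f s - o) xo)).
Let liftV (f : R -> 'cV[R]_3) s := mink (f s - o) xm * expR (k * mink (f s - o) xo).
Let liftD (f : R -> 'cV[R]_3) s :=
  mink (f^`()%classic s) xp * expR (- (k * mink (f s - o) xo)).
Let liftE (f : R -> 'cV[R]_3) s :=
  mink (f^`()%classic s) xm * expR (k * mink (f s - o) xo).
Let liftN (f : R -> 'cV[R]_3) s := mink (f^`()%classic s) xo.

Let lift_inv (c : R -> orbit_space Gam) f1 f2 (s : R) : 0 <= s <= 1 ->
  local_lift c s f1 -> local_lift c s f2 ->
  [/\ liftU f1 s = liftU f2 s, liftV f1 s = liftV f2 s,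
      liftD f1 s = liftD f2 s, liftE f1 s = liftE f2 s & liftN f1 s = liftN f2 s].
Proof.
move=> s01 l1 l2; have [n [[h1 h2 h3] [h4 h5 h6]]] := lift_agree s01 l1 l2.
have l0 : lam != 0 by rewrite gt_eqF// (frame_lam_gt0 fr).
rewrite /liftU /liftV /liftD /liftE /liftN h1 h2 h3 h4 h5 h6 expR_shift expR_shift'.
have ll : lam ^ n * lam ^ (- n) = 1 by rewrite -expfzDr// subrr expr0z.
have e1 x y : lam ^ n * x * (lam ^ (- n) * y) = x * y by rewrite mulrACA ll mul1r.
have e2 x y : lam ^ (- n) * x * (lam ^ n * y) = x * y.
  by rewrite mulrACA [_ ^ _ * _ ^ _]mulrC ll mul1r.
by rewrite !e1 !e2.
Qed.

(** The factors [lam ^ n] and [lam ^ (- n)] cancel in the square norm, so the causal type of a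
    tangent can be tested on any one lift. *)
Lemma lift_mink_sqr (c : R -> orbit_space Gam) f1 f2 (s : R) : 0 <= s <= 1 ->
  local_lift c s f1 -> local_lift c s f2 ->
  mink (f1^`()%classic s) (f1^`()%classic s) = mink (f2^`()%classic s) (f2^`()%classic s).
Proof.
move=> s01 l1 l2; have [n [_ [h4 h5 h6]]] := lift_agree s01 l1 l2.
have l0 : lam != 0 by rewrite gt_eqF// (frame_lam_gt0 fr).
rewrite !(frame_mink_sqr g_mink fr) h4 h5 h6 mulrACA -expfzDr// subrr expr0z.
by rewrite mul1r.
Qed.

(** Reduces to [closed_ode_sign], applied to the invariant quantities of lifts: causality bounds
    [N ^+ 2], nonvanishing of the tangent gives [D + E != 0], and closedness gives the equal end
    values. *)
Lemma closed_causal_sign (c : R -> orbit_space Gam) (t : R) p :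
  causal_curve c -> closed_path c -> 0 <= t <= 1 -> quo_proj Gam p = c t ->
  mink (p - o) xp * mink (p - o) xm < 0.
Proof.
move=> [cC1 ctan] c01 t01 pt.
have lifts s : exists f, local_lift c (clamp s) f by apply: cC1; exact: clamp_itv.
have [L lL] := choice lifts.
have cf f s w : local_lift c s f -> {for s, continuous (fun x => mink (f x - o) w)}.
  move=> l; apply: continuous_mink; apply: cvgB; first exact: local_lift_continuous l.
  exact: cvg_cst.
have cd f s w : local_lift c s f -> {for s, continuous (fun x => mink (f^`()%classic x) w)}.
  by move=> l; apply: continuous_mink; exact: local_lift_continuous_derive1 l.
have ce f s : local_lift c s f -> {for s, continuous (fun x => expR (k * mink (f x - o) xo))}.
  move=> l; apply: (@continuous_comp _ _ _ (fun x => k * mink (f x - o) xo)).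
    by apply: cvgM; [exact: cvg_cst|exact: cf l].
  exact: continuous_expR.
have ce' f s : local_lift c s f ->
  {for s, continuous (fun x => expR (- (k * mink (f x - o) xo)))}.
  move=> l; apply: (@continuous_comp _ _ _ (fun x => - (k * mink (f x - o) xo))).
    by apply: cvgN; apply: cvgM; [exact: cvg_cst|exact: cf l].
  exact: continuous_expR.
pose Q q t := q (L t) (clamp t) : R.
have near_lift (s : R) : 0 < s < 1 -> \forall x \near s, local_lift c x (L s) /\ 0 <= x <= 1.
  move=> /[dup] s01 /andP[s0 s1]; have := lL s.
  rewrite clamp_id ?ltW// => /local_lift_near ls.
  have : s \in `]0, 1[ by rewrite in_itv /= s0.
  move=> /near_in_itvoo ns; near=> x; split; first by near: x.
  have : x \in `]0, 1[ by near: x.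
  by rewrite in_itv /= => /andP[? ?]; rewrite !ltW.
(* Near an interior time [s], [Q q] coincides with [q] of the fixed lift [L s], so it can be
   differentiated there. *)
have QE q : (forall f1 f2 (s : R), 0 <= s <= 1 -> local_lift c s f1 -> local_lift c s f2 ->
    q f1 s = q f2 s) -> forall (s dq : R), 0 < s < 1 ->
    is_derive s 1 (q (L s)) dq -> is_derive s 1 (Q q) dq.
  move=> qinv s dq s01; apply: near_eq_is_derive.
  apply: filterS (near_lift _ s01) => x [lx x01]; rewrite /Q (clamp_id x01).
  by apply: (qinv _ _ _ x01 lx); have := lL x; rewrite clamp_id.
have iU f1 f2 (s : R) : 0 <= s <= 1 -> local_lift c s f1 -> local_lift c s f2 ->
    liftU f1 s = liftU f2 s by move=> s01 l1 l2; have [] := lift_inv s01 l1 l2.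
have iV f1 f2 (s : R) : 0 <= s <= 1 -> local_lift c s f1 -> local_lift c s f2 ->
    liftV f1 s = liftV f2 s by move=> s01 l1 l2; have [] := lift_inv s01 l1 l2.
have iD f1 f2 (s : R) : 0 <= s <= 1 -> local_lift c s f1 -> local_lift c s f2 ->
    liftD f1 s = liftD f2 s by move=> s01 l1 l2; have [] := lift_inv s01 l1 l2.
have iE f1 f2 (s : R) : 0 <= s <= 1 -> local_lift c s f1 -> local_lift c s f2 ->
    liftE f1 s = liftE f2 s by move=> s01 l1 l2; have [] := lift_inv s01 l1 l2.
have iN f1 f2 (s : R) : 0 <= s <= 1 -> local_lift c s f1 -> local_lift c s f2 ->
    liftN f1 s = liftN f2 s by move=> s01 l1 l2; have [] := lift_inv s01 l1 l2.
have UV f s : liftU f s * liftV f s = mink (f s - o) xp * mink (f s - o) xm.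
  by rewrite /liftU /liftV mulrACA expRN mulVf ?mulr1// gt_eqF ?expR_gt0.
have DE f s : liftD f s * liftE f s = mink (f^`()%classic s) xp * mink (f^`()%classic s) xm.
  by rewrite /liftD /liftE mulrACA expRN mulVf ?mulr1// gt_eqF ?expR_gt0.
have tan (s : R) : 0 <= s <= 1 -> causal ((L s)^`()%classic s).
  by move=> s01; apply: (ctan s) => //; exists (L s) => //; have := lL s; rewrite clamp_id.
have NDE (s : R) : 0 <= s <= 1 -> Q liftN s ^+ 2 <= 2 * (Q liftD s * Q liftE s).
  move=> s01; rewrite /Q clamp_id// DE /liftN.
  have := causal_mink_le0 (tan _ s01); rewrite (frame_mink_sqr g_mink fr).
  by rewrite subr_le0.
(* If the sum vanished, [N ^+ 2 <= - 2 * D ^+ 2] would kill [N], [D] and [E], hence the whole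
   tangent vector, which is nonzero. *)
have DE0 (s : R) : 0 <= s <= 1 -> Q liftD s + Q liftE s != 0.
  move=> s01; apply/eqP => DEs; have := NDE _ s01.
  have -> : Q liftE s = - Q liftD s by apply/eqP; rewrite -addr_eq0 addrC DEs.
  move=> N2.
  have D0 : Q liftD s = 0.
    by apply/eqP; rewrite -sqrf_eq0; apply/eqP; have := sqr_ge0 (Q liftD s);
      have := sqr_ge0 (Q liftN s); nra.
  have E0 : Q liftE s = 0 by move: DEs; rewrite D0 add0r.
  have N0 : Q liftN s = 0.
    by apply/eqP; rewrite -sqrf_eq0; apply/eqP; have := sqr_ge0 (Q liftN s); rewrite D0 in N2;
      nra.
  have /negP := causal_neq0 (tan _ s01); apply; apply/eqP.
  move: D0 E0 N0; rewrite /Q clamp_id// /liftD /liftE /liftN.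
  move=> /eqP; rewrite mulf_eq0 [expR _ == 0]gt_eqF ?expR_gt0// orbF => /eqP h1.
  move=> /eqP; rewrite mulf_eq0 [expR _ == 0]gt_eqF ?expR_gt0// orbF => /eqP h2 h3.
  exact: (frame_eq0 g_mink fr).
have L01 : exists n, L 1 1 = aff_app (aff_pow gam n) (L 0 0).
  apply/(quo_proj_eqP gam_iso fr gam_o).
  have l0 := lL 0; have l1 := lL 1; rewrite clamp_id ?lexx ?ler01 // in l0 l1.
  rewrite clamp_id ?lexx ?ler01 // in l1.
  by rewrite (local_lift_eq l0) ?lexx ?ler01// (local_lift_eq l1) ?lexx ?ler01.
have [n Ln] := L01.
have [b1 b2 b3] := aff_pow_coords gam_iso fr gam_o n (L 0 0).
have l0 : lam != 0 by rewrite gt_eqF// (frame_lam_gt0 fr).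
have ll : lam ^ n * lam ^ (- n) = 1 by rewrite -expfzDr// subrr expr0z.
(* The endpoint lifts differ by [gam] to the power [n]: the factor on the null coordinate is undone
   by the shift in the exponential. *)
have U01 : Q liftU 0 = Q liftU 1.
  rewrite /Q !clamp_id ?lexx ?ler01// /liftU Ln b1 b3 expR_shift.
  by rewrite mulrACA ll mul1r.
have V01 : Q liftV 0 = Q liftV 1.
  rewrite /Q !clamp_id ?lexx ?ler01// /liftV Ln b2 b3 expR_shift'.
  by rewrite mulrACA [_ ^ _ * _ ^ _]mulrC ll mul1r.
have dX w (s : R) : 0 < s < 1 ->
  is_derive s 1 (fun x => mink (L s x - o) w) (mink ((L s)^`()%classic s) w).
  move=> s01; apply: is_derive_mink; apply: (@local_lift_derivable _ _ c).
  by have /nbhs_singleton[] := near_lift _ s01.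
have dexp (s b : R) : 0 < s < 1 ->
    is_derive s 1 (fun x => expR (b * mink (L s x - o) xo))
      (expR (b * mink (L s s - o) xo) * (b * mink ((L s)^`()%classic s) xo)).
  move=> s01; apply: (is_derive1_comp (g := fun x => b * mink (L s x - o) xo)).
  exact: is_deriveZ (dX xo _ s01).
have oo_cc (s : R) : 0 < s < 1 -> 0 <= s <= 1 by move=> /andP[*]; rewrite !ltW.
have dU (s : R) : 0 < s < 1 ->
    is_derive s 1 (Q liftU) (Q liftD s - k * Q liftN s * Q liftU s).
  move=> s01; apply: QE => //.
  have := is_deriveM (dX xp _ s01) (dexp _ (- k) s01).
  have -> : liftU (L s) =
    (fun x => mink (L s x - o) xp) * (fun x => expR (- k * mink (L s x - o) xo)).
    by apply/funext => x; rewrite /liftU fctE mulNr.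
  move=> /is_derive_eq; apply.
  by rewrite !scale_regE /Q (clamp_id (oo_cc _ s01)) /liftD /liftU /liftN mulNr; ring.
have dV (s : R) : 0 < s < 1 ->
    is_derive s 1 (Q liftV) (Q liftE s + k * Q liftN s * Q liftV s).
  move=> s01; apply: QE => //.
  have := is_deriveM (dX xm _ s01) (dexp _ k s01).
  have -> : liftV (L s) =
    (fun x => mink (L s x - o) xm) * (fun x => expR (k * mink (L s x - o) xo)).
    by apply/funext => x; rewrite /liftV fctE.
  move=> /is_derive_eq; apply.
  by rewrite !scale_regE /Q (clamp_id (oo_cc _ s01)) /liftE /liftV /liftN; ring.
have lp : local_lift c t (L t) by have := lL t; rewrite clamp_id.
have [m pm] : exists m, p = aff_app (aff_pow gam m) (L t t).
  by apply/(quo_proj_eqP gam_iso fr gam_o); rewrite (local_lift_eq lp).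
have [-> -> _] : [/\ mink (p - o) xp = lam ^ m * mink (L t t - o) xp,
    mink (p - o) xm = lam ^ (- m) * mink (L t t - o) xm & True].
  by rewrite pm; have [-> ->] := aff_pow_coords gam_iso fr gam_o m (L t t).
(* The product of null pairings is the same for every point over [c t], and the exponentials cancel
   in [U * V]. *)
rewrite mulrACA -expfzDr// subrr expr0z mul1r -UV.
have := @closed_ode_sign R k (Q liftU) (Q liftV) (Q liftD) (Q liftE) (Q liftN).
move=> /(_ _ _ _ _ _ dU dV NDE DE0 U01 V01 t t01).
rewrite /Q (clamp_id t01); apply.
- by apply: lift_invariant_continuous lL iU _ => f s l; apply: cvgM; [exact: cf l|exact: ce' l].
- by apply: lift_invariant_continuous lL iV _ => f s l; apply: cvgM; [exact: cf l|exact: ce l].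
- by apply: lift_invariant_continuous lL iD _ => f s l; apply: cvgM; [exact: cd l|exact: ce' l].
- by apply: lift_invariant_continuous lL iE _ => f s l; apply: cvgM; [exact: cd l|exact: ce l].
- by apply: lift_invariant_continuous lL iN _ => f s l; exact: cd l.
Unshelve. all: by end_near.
Qed.

End CausalLoops.

(** * The three regions as sign conditions, and completeness *)

Section Regions.
Context {R : realType}.
Variables (g : 'M[R]_3) (lam : R) (xm xp xo o : 'cV[R]_3).
Hypothesis g_mink : forall u v, mink (g *m u) (g *m v) = mink u v.
Hypothesis fr : eigenframe g lam xm xp xo.

(** Uniqueness of coordinates collapses the existential; abstracting over [P] serves all three
    regions. *)
Lemma frame_coords (P : R -> R -> Prop) p :
  (exists pm pp po, P pm pp /\ p = o + (pm *: xm + pp *: xp + po *: xo)) <->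
  P (- mink (p - o) xp) (- mink (p - o) xm).
Proof.
split=> [[pm [pp [po [Ppp ->]]]]|Pp].
  rewrite (addrC o) addrK; have [-> -> _] := frame_mink_comb g_mink fr pm pp po.
  by rewrite !opprK.
exists (- mink (p - o) xp), (- mink (p - o) xm), (mink (p - o) xo); split => //.
by rewrite -(frame_decomp g_mink fr) addrC subrK.
Qed.

Lemma region_BE p : region_B o xm xp xo p <-> mink (p - o) xp * mink (p - o) xm < 0.
Proof. by rewrite -mulrNN -(frame_coords (fun x y => x * y < 0)). Qed.

Lemma region_GplusE p : region_Gplus o xm xp xo p <->
  mink (p - o) xp <= 0 /\ mink (p - o) xm <= 0.
Proof.
rewrite -oppr_ge0 -[X in _ /\ is_true X]oppr_ge0.
rewrite -(frame_coords (fun x y => 0 <= x /\ 0 <= y)).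
by split=> -[x [y [z]]]; [move=> [h1 h2 h3]|move=> [[h1 h2] h3]]; exists x, y, z.
Qed.

Lemma region_GminusE p : region_Gminus o xm xp xo p <->
  0 <= mink (p - o) xp /\ 0 <= mink (p - o) xm.
Proof.
rewrite -oppr_le0 -[X in _ /\ is_true X]oppr_le0.
rewrite -(frame_coords (fun x y => x <= 0 /\ y <= 0)).
by split=> -[x [y [z]]]; [move=> [h1 h2 h3]|move=> [[h1 h2] h3]]; exists x, y, z.
Qed.

(** A future directed vector pairs nonpositively with both future null directions, so neither
    pairing increases along the ray. *)
Lemma Gplus_future_complete : future_complete (region_Gplus o xm xp xo).
Proof.
move=> p v t /region_GplusE[h1 h2] fv t0; apply/region_GplusE.
rewrite addrAC !(minkDl (p - o)) !minkZl.
have := future_directed_mink_le0 fv (eigenframe_xp_null fr).2.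
have := future_directed_mink_le0 fv (eigenframe_xm_null fr).2.
by move=> *; split; nra.
Qed.

Lemma Gminus_past_complete : past_complete (region_Gminus o xm xp xo).
Proof.
move=> p v t /region_GminusE[h1 h2] /future_directedN fv t0; apply/region_GminusE.
rewrite addrAC !(minkDl (p - o)) !minkZl.
have := future_directed_mink_le0 fv (eigenframe_xp_null fr).2.
have := future_directed_mink_le0 fv (eigenframe_xm_null fr).2.
by rewrite !minkNl => *; split; nra.
Qed.

End Regions.

(** * Translation along the invariant line *)

Section InvariantLine.
Context {R : realType}.
Variables (gam : affine_map R) (lam : R) (xm xp xo o : 'cV[R]_3) (C : set 'cV[R]_3).
Hypothesis gam_iso : mink_isometry gam.
Hypothesis gam_free : fixed_point_free gam.
Hypothesis fr : eigenframe (lin_part gam) lam xm xp xo.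
Hypothesis C_inv : invariant_line gam C.
Hypothesis oC : C o.

(* The direction u of the line is an eigenvector; were its eigenvalue m different
   from 1, the affine map induced on the line would have a fixed point. *)
Lemma invariant_line_translation : exists2 a, a != 0 & aff_app gam o = o + a *: xo.
Proof.
have [g_mink _ _] := gam_iso.
have [[q [u [/eqP u0 CE]]] gC] := C_inv.
have Cgam p : C p -> C (aff_app gam p) by move=> Cp; rewrite -gC; exists p.
have [t0 _ ot0] : [set q + t *: u | t in [set: R]] o by rewrite -CE.
have [t1 _ t1E] : [set q + t *: u | t in [set: R]] (aff_app gam o).
  by rewrite -CE; exact: Cgam.
have [t2 _ t2E] : [set q + t *: u | t in [set: R]] (aff_app gam (o + u)).
  rewrite -CE; apply: Cgam; rewrite CE; exists (t0 + 1) => //.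
  by rewrite scalerDl scale1r addrA ot0.
have go : aff_app gam o = o + (t1 - t0) *: u.
  by rewrite -t1E -ot0 -addrA -scalerDl [t0 + _]addrC subrK.
have gD v : aff_app gam (o + v) = aff_app gam o + lin_part gam *m v.
  by rewrite /aff_app mulmxDr addrAC.
have gu : lin_part gam *m u = (t2 - t1) *: u.
  have : aff_app gam (o + u) - aff_app gam o = (t2 - t1) *: u.
    by rewrite -t1E -t2E opprD addrACA subrr add0r -scalerBl.
  by rewrite gD addrAC subrr add0r.
have m1 : t2 - t1 = 1.
  apply/eqP/negPn/negP => m1.
  (* The parameter solves [s = (t1 - t0) + (t2 - t1) * s]. *)
  case: (@gam_free (o + ((t1 - t0) / (1 - (t2 - t1))) *: u)).
  rewrite gD go -scalemxAr gu scalerA -addrA -scalerDl; congr (_ + _ *: _).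
  by field; rewrite subr_eq0 eq_sym.
rewrite m1 scale1r in gu.
(* Since [lam] and [lam^-1] differ from 1, a fixed vector pairs to zero with [xp] and [xm], so [u]
   is a multiple of [xo]. *)
have [] := frame_mink_mul g_mink fr u; rewrite gu => up um _.
have lam0 := frame_lam_gt0 fr; have lam1 := frame_lam_lt1 fr.
have lamV1 : 1 < lam^-1 by have /andP[] := eigenframe_lam fr.
have {}up : mink u xp = 0 by nra.
have {}um : mink u xm = 0 by nra.
have uE := frame_decomp g_mink fr u.
rewrite up um oppr0 !scale0r !add0r in uE.
exists ((t1 - t0) * mink u xo); last by rewrite go {1}uE scalerA.
rewrite mulf_neq0//.
  apply/eqP => t10; case: (@gam_free o).
  by rewrite go t10 scale0r addr0.
by apply: contra u0 => /eqP h; rewrite uE h scale0r.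
Qed.

End InvariantLine.

(** * Timelike displacements and closed timelike segments *)

Section TimelikeSegments.
Context {R : realType}.

(** The cube of the Bernoulli-type bound [m * h <= (1 + h) ^+ m]; cubic growth suffices to beat a
    square. *)
Lemma cube_le_expr (h : R) m : 0 <= h -> m%:R ^+ 3 * h ^+ 3 <= (1 + h) ^+ (m * 3).
Proof.
move=> h0; rewrite -exprMn exprM; apply: lerXn2r;
  rewrite ?nnegrE ?mulr_ge0// ?exprn_ge0 ?addr_ge0//.
elim: m => [|m IH]; first by rewrite mul0r expr0 ler01.
have : 1 <= (1 + h) ^+ m by rewrite exprn_ege1// lerDl.
by rewrite exprS -natr1 mulrDl mul1r; nra.
Qed.

(** The [- 2] matches the constant in [(lam ^ n - 1) * (lam ^ (- n) - 1) = 2 - lam ^ n - lam ^ (-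
    n)]. *)
Lemma exists_square_lt_expr (x A c : R) : 1 < x -> 0 < c ->
  exists n : nat, n%:R ^+ 2 * A ^+ 2 < c * (x ^+ n - 2).
Proof.
move=> x1 c0; pose h := x - 1; have h0 : 0 < h by rewrite subr_gt0.
(* With [n = 3 m] and [m >= 1], the cubic bound reduces the goal to [m ^+ 2 * (9 * A ^+ 2 + 2 * c) <
   m ^+ 3 * (c * h ^+ 3)], that is, to [M < m]. *)
pose M := (9 * A ^+ 2 + 2 * c) / (c * h ^+ 3).
have ch0 : 0 < c * h ^+ 3 by rewrite mulr_gt0// exprn_gt0.
have M0 : 0 <= M.
  by apply: divr_ge0; [have := sqr_ge0 A; lra|exact: ltW].
pose m := (Num.bound M).+1.
have Mm : M < m%:R.
  by apply: lt_trans (archi_boundP M0) _; rewrite ltr_nat.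
have m1 : 1 <= m%:R :> R by rewrite ler1n.
exists (m * 3)%N.
have cube := cube_le_expr m (ltW h0).
have xE : x = 1 + h by rewrite /h addrC subrK.
have : 9 * A ^+ 2 + 2 * c < m%:R * (c * h ^+ 3) by rewrite -ltr_pdivrMr.
rewrite -xE in cube; rewrite natrM.
move: (x ^+ (m * 3)) (h ^+ 3) (m%:R : R) (A ^+ 2) (sqr_ge0 A) m1 cube => X H r B B0 r1 cube key.
have k2 : r ^+ 2 * (9 * B + 2 * c) < r ^+ 2 * (r * (c * H)).
  by rewrite ltr_pM2l// exprn_gt0// (lt_le_trans ltr01).
have k3 : c * (r ^+ 3 * H) <= c * X by rewrite ler_pM2l.
have r2 : 1 <= r ^+ 2 by rewrite exprn_ege1.
have k4 : 2 * c <= r ^+ 2 * (2 * c) by rewrite ler_peMl// mulr_ge0// ltW.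
have e3 : c * (r ^+ 3 * H) = r ^+ 2 * (r * (c * H)) by ring.
rewrite e3 in k3; move: k2 k3; rewrite mulrDr [c * (X - 2)]mulrBr.
have -> : (r * 3) ^+ 2 * B = r ^+ 2 * (9 * B) by ring.
move: (r ^+ 2 * (9 * B)) (r ^+ 2 * (r * (c * H))) (r ^+ 2 * (2 * c)) k4 (c * X) => *; lra.
Qed.

Variables (gam : affine_map R) (lam : R) (xm xp xo o : 'cV[R]_3) (a : R).
Hypothesis gam_iso : mink_isometry gam.
Hypothesis fr : eigenframe (lin_part gam) lam xm xp xo.
Hypothesis gam_o : aff_app gam o = o + a *: xo.
Hypothesis a0 : a != 0.

Lemma exists_timelike_displacement p : mink (p - o) xp * mink (p - o) xm < 0 ->
  exists n, timelike (aff_app (aff_pow gam n) p - p).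
Proof.
move=> XY; have [g_mink _ _] := gam_iso.
have lam0 := frame_lam_gt0 fr.
have lamV1 : 1 < lam^-1 by have /andP[] := eigenframe_lam fr.
have c0 : 0 < - (2 * (mink (p - o) xp * mink (p - o) xm)) by lra.
have [n nE] := exists_square_lt_expr a lamV1 c0.
exists n%:Z; rewrite /timelike (frame_mink_sqr g_mink fr).
have [h1 h2 h3] := aff_pow_coords gam_iso fr gam_o n p.
have -> : aff_app (aff_pow gam n) p - p = (aff_app (aff_pow gam n) p - o) - (p - o).
  by rewrite opprB addrA subrK.
rewrite !(minkBl (_ - o) (p - o)) h1 h2 h3.
rewrite exprVn in nE; rewrite -exprnN -exprnP.
have l0 : 0 < lam ^+ n by rewrite exprn_gt0.
have ll : lam ^+ n * lam ^- n = 1 by rewrite divff// gt_eqF.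
have -> : mink (p - o) xo + n%:~R * a - mink (p - o) xo = n%:R * a by rewrite addrC addKr.
move: XY nE l0 ll {h1 h2 h3 c0}.
move: (mink (p - o) xp) (mink (p - o) xm) (lam ^+ n) (lam ^- n) (n%:R : R).
move=> X Y L V r XY nE L0 LV.
(* As [L * V = 1], this is [X * Y * (2 - L - V)]. The contribution of [L > 0] has the favourable
   sign, and [nE] controls the rest. *)
have -> : (L * X - X) * (V * Y - Y) = X * Y * (L * V - L - V + 1) by ring.
rewrite LV exprMn; nra.
Qed.

Lemma timelike_segment_CTC p n : timelike (aff_app (aff_pow gam n) p - p) ->
  CTC_region (cyclic_group gam) (quo_proj (cyclic_group gam) p).
Proof.
set w := aff_app _ p - p => tw.
pose f (s : R) : 'cV[R]_3 := p + s *: w.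
have dij (s : R) i j : is_derive s 1 (fun x => f x i j) (w i j).
  have := is_deriveD (is_derive_cst (p i j) s 1) (is_deriveZ (w i j) (is_derive_id s 1)).
  set F := (X in is_derive s 1 X _); have -> : F = (fun x => f x i j).
    by apply/funext => x; rewrite /F /f !mxE !fctE /= scale_regE mulrC.
  by move=> /is_derive_eq; apply; rewrite add0r scale_regE mulr1.
have df (s : R) : derivable f s 1.
  by apply/derivable_mxP => i j; have [] := dij s i j.
have f'E : f^`()%classic = cst w.
  apply/funext => s; apply/matrixP => i j; rewrite derive1E (derive_mx (df s)) mxE.
  by have [_ ->] := dij s i j.
pose c s := quo_proj (cyclic_group gam) (f s).
(* The segment extends to a full affine line, so [f] is one lift valid at every time, endpoints
   included. *)
have lf t : local_lift c t f.
  exists setT; split => //; first exact: openT.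
  by move=> s _; split; [exact: df|rewrite f'E; exact: cvg_cst].
exists c; split.
- split=> [t _|t _ t01 [f2 lf2 ->]]; first by exists f.
  (* A tangent may come from any lift, but its square norm is that of the constant velocity [w]. *)
  by rewrite /timelike (lift_mink_sqr gam_iso fr gam_o a0 t01 lf2 (lf t)) f'E.
- rewrite /closed_path /c; apply/(quo_proj_eqP gam_iso fr gam_o); exists n.
  by rewrite /f scale0r scale1r addr0 addrC subrK.
- by exists 0; rewrite ?lexx ?ler01// /c /f scale0r addr0.
Qed.

End TimelikeSegments.

(** * Causal structure of the quotient by [gam] *)

Unset Implicit Arguments.

Theorem theorem2p2 (R : realType) (gam : affine_map R)
    (lam : R) (xm xp xo : 'cV[R]_3) (C : set 'cV[R]_3) (o : 'cV[R]_3)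
    (gam_hyp : hyperbolic gam) (gam_free : fixed_point_free gam)
    (frame : eigenframe (lin_part gam) lam xm xp xo)
    (C_inv : invariant_line gam C) (oC : C o) :
  let Gam := cyclic_group gam in
  let B := region_B o xm xp xo in
  let Gplus := region_Gplus o xm xp xo in
  let Gminus := region_Gminus o xm xp xo in
  [/\ T_region Gam = B /\ CTC_region Gam = quo_proj Gam @` B,
      F_region Gam = Gplus `|` Gminus,
      future_complete Gplus /\ past_complete Gminus
    & closed_curves_spacelike (quo_proj Gam @` Gplus) /\
      closed_curves_spacelike (quo_proj Gam @` Gminus)].
Proof.
move=> Gam B Gplus Gminus.
have [gam_iso _] := gam_hyp; have [g_mink _ _] := gam_iso.
have [a a0 gam_o] := invariant_line_translation gam_iso gam_free frame C_inv oC.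
have sign := closed_causal_sign gam_iso frame gam_o a0.
have BE := region_BE o g_mink frame.
have TB : T_region Gam = B.
  (* Points of [B] lie on projected timelike segments; conversely, a timelike curve is causal and
     [sign] applies. *)
  apply/seteqP; split=> p; last first.
    move=> /BE /(exists_timelike_displacement gam_iso frame gam_o)[n].
    exact: (timelike_segment_CTC gam_iso frame gam_o a0).
  move=> [c [[c1 ctan] c01 [t t01 ct]]]; apply/BE; apply: (sign c t) => //.
  by split=> // s v s01 /(ctan _ _ s01); left.
split.
- split=> //; rewrite -TB; apply/seteqP; split=> [x xC|_ [p Tp <-] //].
  (* A point of the quotient is an orbit, hence the image of some [p], and lying in [T_region]
     depends only on that image. *)
  case: x xC => x /[dup] /set_mem[p _ px] xP xC.
  have qp : quo_proj Gam p = SigSub xP by apply: val_inj.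
  by exists p => //; rewrite /T_region /= qp.
- rewrite /F_region TB; apply/seteqP; split=> p.
    move=> /BE/negP; rewrite -leNgt => XY.
    have [h|h] := lerP (mink (p - o) xp) 0; have [h'|h'] := lerP (mink (p - o) xm) 0.
    + by left; apply/(region_GplusE o g_mink frame).
    (* When one pairing is positive and the other nonpositive, the nonnegative product forces the
       latter to be 0. *)
    + by right; apply/(region_GminusE o g_mink frame); split; nra.
    + by right; apply/(region_GminusE o g_mink frame); split; nra.
    + by right; apply/(region_GminusE o g_mink frame); split; exact: ltW.
  case=> [/(region_GplusE o g_mink frame)|/(region_GminusE o g_mink frame)] [h1 h2] /BE; nra.
- by split; [exact: Gplus_future_complete frame|exact: Gminus_past_complete frame].
(* A closed causal curve would have a negative product of null pairings over its starting point,
   against the equal weak signs in [Gplus] and [Gminus]; only the spacelike alternative survives. *)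
- split=> c c01 cX [//|cc].
    have h01 : 0 <= (0 : R) <= 1 by rewrite lexx ler01.
    have [p /(region_GplusE o g_mink frame)[h1 h2] pc] := cX 0 h01.
    have := sign c 0 p cc c01 h01 pc; nra.
  have h01 : 0 <= (0 : R) <= 1 by rewrite lexx ler01.
  have [p /(region_GminusE o g_mink frame)[h1 h2] pc] := cX 0 h01.
  have := sign c 0 p cc c01 h01 pc; nra.
Qed.
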